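(* Let $a,b,p,q$ be real numbers with $p^2+4q\neq 0$ and $p+q\neq 1$, let $Q_{w,n}$ ($n\ge 0$) be the Horadam quaternions with parameters $(a,b;p,q)$, and let $\alpha=\frac{p+\sqrt{p^2+4q}}{2}$, $\beta=\frac{p-\sqrt{p^2+4q}}{2}$, $A=b-a\beta$, $B=b-a\alpha$, $\underline{\alpha}=1+i\alpha+j\alpha^2+k\alpha^3$, $\underline{\beta}=1+i\beta+j\beta^2+k\beta^3$. Then for every integer $n\ge 0$, $$\sum_{m=0}^{n}Q_{w,m}=\frac{1}{\alpha-\beta}\left(\frac{B\,\underline{\beta}\,\beta^{n+1}}{1-\beta}-\frac{A\,\underline{\alpha}\,\alpha^{n+1}}{1-\alpha}\right)+K,$$ where $$K=\frac{(a+b-ap)+i(b+aq)+j(bp+aq+bq)+k\left[b(p^2+q)+(a+b)pq+aq^2\right]}{1-p-q}.$$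
   Context: The Horadam sequence $W_n=W_n(a,b;p,q)$ is defined by $W_0=a$, $W_1=b$ and $W_n=pW_{n-1}+qW_{n-2}$ for $n\ge 2$. The Horadam quaternions are $Q_{w,n}=W_n+W_{n+1}i+W_{n+2}j+W_{n+3}k$ for $n\ge 0$, where $i,j,k$ are the Hamilton units with $i^2=j^2=k^2=ijk=-1$. When $p^2+4q<0$ the numbers $\alpha,\beta$ are complex scalars and the identity is read in the complexified quaternion algebra $\mathbb{H}\otimes_{\mathbb{R}}\mathbb{C}$, where complex scalars are central (a square root of $p^2+4q$ in $\mathbb{C}$ being fixed). *)

(* Defs.v *)
From HB Require Import structures.
From mathcomp Require Import all_boot all_order all_algebra.
From mathcomp Require Import reals.
From mathcomp Require Import complex.
From mathcomp Require Import ring.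

Set Implicit Arguments.
Unset Strict Implicit.
Unset Printing Implicit Defensive.

Import GRing.Theory.
Local Open Scope ring_scope.

(* Hamilton quaternions over a commutative ring [F], with basis 1, i, j, k and
   central scalars.  [quat R] is the real algebra H; as H is free over R with
   basis 1, i, j, k, [quat R[i]] is H (x)_R C, in which the imaginary unit of
   R[i] is a central scalar, distinct from the quaternion unit [qi]. *)
Record quat (F : Type) : Type := Quat { q0 : F; q1 : F; q2 : F; q3 : F }.

Definition quat_to_prod (F : Type) (x : quat F) : F * F * F * F :=
  (q0 x, q1 x, q2 x, q3 x).
Definition prod_to_quat (F : Type) (x : F * F * F * F) : quat F :=
  Quat x.1.1.1 x.1.1.2 x.1.2 x.2.
Lemma quat_to_prodK (F : Type) : cancel (@quat_to_prod F) (@prod_to_quat F).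
Proof. by case. Qed.

HB.instance Definition _ (F : eqType) :=
  Equality.copy (quat F) (can_type (@quat_to_prodK F)).
HB.instance Definition _ (F : choiceType) :=
  Choice.copy (quat F) (can_type (@quat_to_prodK F)).

Section QuatAlgebra.
Variable F : comNzRingType.
Implicit Types (x y z : quat F) (c d : F).

Definition quat_zero : quat F := Quat 0 0 0 0.
Definition quat_opp x : quat F := Quat (- q0 x) (- q1 x) (- q2 x) (- q3 x).
Definition quat_add x y : quat F :=
  Quat (q0 x + q0 y) (q1 x + q1 y) (q2 x + q2 y) (q3 x + q3 y).
Definition quat_one : quat F := Quat 1 0 0 0.
Definition quat_mul x y : quat F :=
  Quat (q0 x * q0 y - q1 x * q1 y - q2 x * q2 y - q3 x * q3 y)
       (q0 x * q1 y + q1 x * q0 y + q2 x * q3 y - q3 x * q2 y)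
       (q0 x * q2 y - q1 x * q3 y + q2 x * q0 y + q3 x * q1 y)
       (q0 x * q3 y + q1 x * q2 y - q2 x * q1 y + q3 x * q0 y).
Definition quat_scale c x : quat F :=
  Quat (c * q0 x) (c * q1 x) (c * q2 x) (c * q3 x).

Lemma quat_addA : associative quat_add.
Proof. by move=> [????] [????] [????]; rewrite /quat_add /= !addrA. Qed.
Lemma quat_addC : commutative quat_add.
Proof. by move=> [????] [????]; congr Quat; rewrite /= addrC. Qed.
Lemma quat_add0 : left_id quat_zero quat_add.
Proof. by move=> [????]; rewrite /quat_add /= !add0r. Qed.
Lemma quat_addN : left_inverse quat_zero quat_opp quat_add.
Proof. by move=> [????]; rewrite /quat_add /= !addNr. Qed.

HB.instance Definition _ :=
  GRing.isZmodule.Build (quat F) quat_addA quat_addC quat_add0 quat_addN.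

Lemma quat_mulA : associative quat_mul.
Proof. by move=> [????] [????] [????]; congr Quat => /=; ring. Qed.
Lemma quat_mul1l : left_id quat_one quat_mul.
Proof. by move=> [????]; congr Quat => /=; ring. Qed.
Lemma quat_mul1r : right_id quat_one quat_mul.
Proof. by move=> [????]; congr Quat => /=; ring. Qed.
Lemma quat_mulDl : left_distributive quat_mul quat_add.
Proof. by move=> [????] [????] [????]; congr Quat => /=; ring. Qed.
Lemma quat_mulDr : right_distributive quat_mul quat_add.
Proof. by move=> [????] [????] [????]; congr Quat => /=; ring. Qed.
Lemma quat_one_neq0 : quat_one != quat_zero.
Proof. by apply/eqP => -[] /eqP; rewrite oner_eq0. Qed.

HB.instance Definition _ := GRing.Zmodule_isNzRing.Build (quat F)
  quat_mulA quat_mul1l quat_mul1r quat_mulDl quat_mulDr quat_one_neq0.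

Lemma quat_scaleA c d x : quat_scale c (quat_scale d x) = quat_scale (c * d) x.
Proof. by congr Quat => /=; rewrite mulrA. Qed.
Lemma quat_scale1 : left_id 1 quat_scale.
Proof. by move=> [????]; rewrite /quat_scale /= !mul1r. Qed.
Lemma quat_scaleDr : right_distributive quat_scale +%R.
Proof. by move=> c x y; congr Quat => /=; rewrite mulrDr. Qed.
Lemma quat_scaleDl x : {morph quat_scale^~ x : c d / c + d}.
Proof. by move=> c d; congr Quat => /=; rewrite mulrDl. Qed.

HB.instance Definition _ := GRing.Zmodule_isLmodule.Build F (quat F)
  quat_scaleA quat_scale1 quat_scaleDr quat_scaleDl.

Lemma quat_scaleAl c x y : c *: (x * y) = c *: x * y.
Proof. by congr Quat => /=; ring. Qed.

HB.instance Definition _ :=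
  GRing.Lmodule_isLalgebra.Build F (quat F) quat_scaleAl.

Lemma quat_scaleAr c x y : c *: (x * y) = x * (c *: y).
Proof. by congr Quat => /=; ring. Qed.

HB.instance Definition _ :=
  GRing.Lalgebra_isAlgebra.Build F (quat F) quat_scaleAr.

Definition qi : quat F := Quat 0 1 0 0.
Definition qj : quat F := Quat 0 0 1 0.
Definition qk : quat F := Quat 0 0 0 1.

Lemma hamilton :
  [/\ qi ^+ 2 = -1, qj ^+ 2 = -1, qk ^+ 2 = -1 & qi * qj * qk = -1].
Proof. by split; congr Quat => /=; ring. Qed.

Lemma quatE x : x = q0 x *: 1 + q1 x *: qi + q2 x *: qj + q3 x *: qk.
Proof. by case: x => ????; congr Quat => /=; ring. Qed.

End QuatAlgebra.

Arguments qi {F}.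
Arguments qj {F}.
Arguments qk {F}.

Definition quat_map (F G : Type) (f : F -> G) (x : quat F) : quat G :=
  Quat (f (q0 x)) (f (q1 x)) (f (q2 x)) (f (q3 x)).

Section QuatMap.
Variables (F G : comNzRingType) (f : {rmorphism F -> G}).

Lemma quat_map_is_additive : zmod_morphism (quat_map f).
Proof. by move=> x y; congr Quat; rewrite /= rmorphB. Qed.

HB.instance Definition _ :=
  GRing.isZmodMorphism.Build (quat F) (quat G) (quat_map f)
    quat_map_is_additive.

Lemma quat_map_is_multiplicative : monoid_morphism (quat_map f).
Proof.
split; first by congr Quat; rewrite /= ?rmorph1 ?rmorph0.
by move=> x y; congr Quat; rewrite /= ?(rmorphB, rmorphD, rmorphM).
Qed.

HB.instance Definition _ :=
  GRing.isMonoidMorphism.Build (quat F) (quat G) (quat_map f)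
    quat_map_is_multiplicative.

End QuatMap.

(* The inclusion x |-> x (x) 1 of H into H (x)_R C. *)
Definition quatC (R : realType) (x : quat R) : quat R[i] :=
  quat_map (real_complex R) x.

Fixpoint horadam (R : pzRingType) (a b p q : R) (n : nat) : R :=
  match n with
  | 0 => a
  | m.+1 => match m with
            | 0 => b
            | l.+1 => p * horadam a b p q m + q * horadam a b p q l
            end
  end.

Definition horadam_quat (R : comNzRingType) (a b p q : R) (n : nat) : quat R :=
  let W := horadam a b p q in
  W n *: 1 + W n.+1 *: qi + W n.+2 *: qj + W n.+3 *: qk.

(* The quaternion written as the underlined scalar \underline{x}. *)
Definition quat_under (F : comNzRingType) (x : F) : quat F :=
  1 + x *: qi + x ^+ 2 *: qj + x ^+ 3 *: qk.

(* Main.v *)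
(* By the Binet formula W_n = (A alpha^n - B beta^n) / (alpha - beta), every
   component of the sum is a difference of two geometric sums.  Since
   (1 - alpha) (1 - beta) = 1 - p - q, no ratio is equal to 1, and K collects
   the parts that do not depend on n. *)
Require Import Defs.
From mathcomp Require Import all_boot all_order all_algebra.
From mathcomp Require Import reals complex.
From mathcomp Require Import ring.

Import Order.TTheory GRing.Theory Num.Theory.
Local Open Scope ring_scope.
Local Open Scope complex_scope.

Lemma horadamSS (R : pzRingType) (a b p q : R) (n : nat) :
  horadam a b p q n.+2 = p * horadam a b p q n.+1 + q * horadam a b p q n.
Proof. by []. Qed.

(** Writing [p = x + y] and [q = - (x * y)] makes [x] and [y] the characteristic roots by
    construction, so [field] needs no side relation. *)
Lemma horadam_binet (F : fieldType) (a b x y : F) (n : nat) : x != y ->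
  horadam a b (x + y) (- (x * y)) n =
  ((b - a * y) * x ^+ n - (b - a * x) * y ^+ n) / (x - y).
Proof.
rewrite -subr_eq0 => xy0.
(* The recurrence has order two, so the induction carries two consecutive values. *)
suff: horadam a b (x + y) (- (x * y)) n =
        ((b - a * y) * x ^+ n - (b - a * x) * y ^+ n) / (x - y) /\
      horadam a b (x + y) (- (x * y)) n.+1 =
        ((b - a * y) * x ^+ n.+1 - (b - a * x) * y ^+ n.+1) / (x - y) by case.
elim: n => [|n [IHn IHn1]]; first by split=> /=; field.
split=> //.
by rewrite horadamSS IHn1 IHn !exprS; field.
Qed.

Lemma horadam_quatE (F : comNzRingType) (a b p q : F) (n : nat) :
  horadam_quat a b p q n =
  Quat (horadam a b p q n) (horadam a b p q n.+1)
       (horadam a b p q n.+2) (horadam a b p q n.+3).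
Proof. by rewrite [RHS]quatE. Qed.

Lemma quat_underE (F : comNzRingType) (x : F) :
  quat_under x = Quat 1 x (x ^+ 2) (x ^+ 3).
Proof. by rewrite [RHS]quatE /= scale1r. Qed.

(** The constant K, over an arbitrary field so that it serves both [R] and [R[i]]. *)
Definition horadam_sum_cst {F : fieldType} (a b p q : F) : quat F :=
  (1 - p - q)^-1 *:
    ((a + b - a * p) *: 1
     + (b + a * q) *: qi
     + (b * p + a * q + b * q) *: qj
     + (b * (p ^+ 2 + q) + (a + b) * p * q + a * q ^+ 2) *: qk).

Lemma horadam_sum_cstE (F : fieldType) (a b p q : F) :
  horadam_sum_cst a b p q =
  Quat ((1 - p - q)^-1 * (a + b - a * p))
       ((1 - p - q)^-1 * (b + a * q))
       ((1 - p - q)^-1 * (b * p + a * q + b * q))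
       ((1 - p - q)^-1 *
         (b * (p ^+ 2 + q) + (a + b) * p * q + a * q ^+ 2)).
Proof.
by rewrite [RHS]quatE /= /horadam_sum_cst !scalerDr !scalerA.
Qed.

Lemma sum_horadam_quat (F : fieldType) (a b p q x y : F) (n : nat) :
  x + y = p -> x * y = - q -> x != y -> p + q != 1 ->
  \sum_(0 <= m < n) horadam_quat a b p q m =
  (x - y)^-1 *:
    (((b - a * x) * y ^+ n / (1 - y)) *: quat_under y
     - ((b - a * y) * x ^+ n / (1 - x)) *: quat_under x)
  + horadam_sum_cst a b p q.
Proof.
move=> <- /eqP; rewrite eq_sym eqr_oppLR => /eqP -> xy pq.
have xy0 : x - y != 0 by rewrite subr_eq0.
have pq0 : 1 - (x + y) - - (x * y) != 0.
  by rewrite -addrA -opprD subr_eq0 eq_sym.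
have : (1 - x) * (1 - y) != 0.
  by rewrite (_ : _ * _ = 1 - (x + y) - - (x * y)) //; ring.
rewrite mulf_eq0 negb_or => /andP[x1 y1].
(* The base case is the empty sum, where the two root terms must cancel K. In the step K drops out:
   the closed form grows by [(x - y)^-1] times A x^n [quat_under x] - B y^n [quat_under y], the
   Binet form of the new summand. *)
elim: n => [|n IHn].
  rewrite big_geq // !quat_underE horadam_sum_cstE.
  by congr Quat => /=; field; rewrite x1 y1 xy0 pq0.
rewrite big_nat_recr //= IHn horadam_quatE !quat_underE horadam_sum_cstE.
rewrite !horadam_binet // !exprS.
by congr Quat => /=; field; rewrite x1 y1 xy0 pq0.
Qed.

(** Since [x - y = s], a nonzero [s] separates the roots. Any square root [s] of the discriminant is
    allowed, which covers both halves of the theorem. *)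
Lemma sum_horadam_quat_disc (F : fieldType) (a b p q s : F) (n : nat) :
  2 != 0 :> F -> s != 0 -> s ^+ 2 = p ^+ 2 + 4 * q -> p + q != 1 ->
  let x := (p + s) / 2 in let y := (p - s) / 2 in
  \sum_(0 <= m < n) horadam_quat a b p q m =
  (x - y)^-1 *:
    (((b - a * x) * y ^+ n / (1 - y)) *: quat_under y
     - ((b - a * y) * x ^+ n / (1 - x)) *: quat_under x)
  + horadam_sum_cst a b p q.
Proof.
move=> two0 s0 sE pq x y; apply: sum_horadam_quat => //; rewrite /x /y.
- by field.
(* A difference of squares exposes [s ^+ 2], the only form in which [sE] can be rewritten. *)
- have -> : (p + s) / 2 * ((p - s) / 2) = (p ^+ 2 - s ^+ 2) / 4.
    by field; rewrite (_ : 4 = 2 * 2) ?mulf_neq0 //; ring.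
  by rewrite sE; field; rewrite (_ : 4 = 2 * 2) ?mulf_neq0 //; ring.
- by rewrite -subr_eq0 (_ : _ - _ = s) //; field.
Qed.

Section Morphism.
Variables (F G : fieldType) (f : {rmorphism F -> G}).

Lemma rmorph_horadam (a b p q : F) (n : nat) :
  f (horadam a b p q n) = horadam (f a) (f b) (f p) (f q) n.
Proof.
elim/ltn_ind: n => -[|[|n]] IHn //.
by rewrite !horadamSS rmorphD !rmorphM !IHn.
Qed.

Lemma quat_map_horadam (a b p q : F) (n : nat) :
  quat_map f (horadam_quat a b p q n) =
  horadam_quat (f a) (f b) (f p) (f q) n.
Proof. by rewrite !horadam_quatE /quat_map !rmorph_horadam. Qed.

(** A field morphism preserves inverses, so the factor [(1 - p - q)^-1] is carried over. *)
Lemma quat_map_sum_cst (a b p q : F) :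
  quat_map f (horadam_sum_cst a b p q) =
  horadam_sum_cst (f a) (f b) (f p) (f q).
Proof.
rewrite !horadam_sum_cstE /quat_map /=.
by rewrite !(rmorphM, fmorphV, rmorphD, rmorphN, rmorphXn, rmorph1).
Qed.

End Morphism.

Theorem theorem3p7 (R : realType) (a b p q : R) :
  p ^+ 2 + 4 * q != 0 -> p + q != 1 ->
  let K : quat R :=
    (1 - p - q)^-1 *:
      ((a + b - a * p) *: 1
       + (b + a * q) *: qi
       + (b * p + a * q + b * q) *: qj
       + (b * (p ^+ 2 + q) + (a + b) * p * q + a * q ^+ 2) *: qk) in
  (* real roots: the identity in H *)
  (0 < p ^+ 2 + 4 * q ->
   let s : R := Num.sqrt (p ^+ 2 + 4 * q) in
   let alpha := (p + s) / 2 in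
   let beta := (p - s) / 2 in
   let A := b - a * beta in
   let B := b - a * alpha in
   forall n : nat,
     \sum_(0 <= m < n.+1) horadam_quat a b p q m =
     (alpha - beta)^-1 *:
       ((B * beta ^+ n.+1 / (1 - beta)) *: quat_under beta
        - (A * alpha ^+ n.+1 / (1 - alpha)) *: quat_under alpha)
     + K)
  /\
  (* any sign of the discriminant: the identity in the complexification of H,
     for either complex square root s of p^2 + 4q *)
  (forall s : R[i], s ^+ 2 = (p ^+ 2 + 4 * q)%:C ->
   let alpha := (p%:C + s) / 2 in
   let beta := (p%:C - s) / 2 in
   let A := b%:C - a%:C * beta in
   let B := b%:C - a%:C * alpha in
   forall n : nat,
     \sum_(0 <= m < n.+1) quatC (horadam_quat a b p q m) =
     (alpha - beta)^-1 *:
       ((B * beta ^+ n.+1 / (1 - beta)) *: quat_under beta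
        - (A * alpha ^+ n.+1 / (1 - alpha)) *: quat_under alpha)
     + quatC K).
Proof.
move=> disc0 pq K; split=> [disc_gt0 s | s sE] alpha beta A B n.
  apply: sum_horadam_quat_disc => //; first by rewrite pnatr_eq0.
    by rewrite sqrtr_eq0 -ltNge.
  by rewrite sqr_sqrtr // ltW.
(* Pushing the embedding onto the parameters turns the claim into the closed form over [R[i]]. *)
rewrite /quatC (quat_map_sum_cst _ _ (real_complex R)).
under eq_bigr do rewrite quat_map_horadam.
apply: sum_horadam_quat_disc.
- by rewrite pnatr_eq0.
(* [s] is nonzero because its square is the image of the nonzero discriminant under an injective
   morphism. *)
- by rewrite -sqrf_eq0 sE fmorph_eq0.
- by rewrite sE rmorphD rmorphXn rmorphM rmorph_nat.
- by rewrite -rmorphD fmorph_eq1.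
Qed.
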